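(* Let $(T,f)$ be a top-representation of a quiver $\Gamma$, and for each vertex $i$ let $T'(i),T''(i)$ be subspaces of $T(i)$ such that $T(i)=(T'(i))^\circ\cup(T''(i))^\circ$ (interiors taken in $T(i)$) and such that $f_\alpha(T'(i))\subset T'(j)$ and $f_\alpha(T''(i))\subset T''(j)$ for every arrow $\alpha:i\to j$. Then for $n=0,1$, $$H_n\left(\textstyle\lim^{\Gamma,\bullet}\left(\frac{S^\Gamma(T,f)}{S^\Gamma(T',f)+S^\Gamma(T'',f)}\right)\right)=0.$$
   Context: A quiver $\Gamma=(\Gamma_0,\Gamma_1)$ is an oriented graph. A top-representation $(T,f)$ of $\Gamma$ is a family of topological spaces $T(i)$, $i\in\Gamma_0$, with a continuous map $f_\alpha:T(i)\to T(j)$ for each arrow $\alpha:i\to j$; $(T',f)$ and $(T'',f)$ denote the top-representations given by the subspaces with the restricted maps. $S(X)$ is the singular chain complex of $X$ (with $S_{-1}(X)=0$, $S(\emptyset)=0$). $\mathbf C\text{-}\mathbf{Rep}\,\Gamma$ is the category of $\Gamma$-representations by chain complexes of abelian groups: a chain complex $C(i)$ for each vertex $i$ and a chain map $g_\alpha:C(i)\to C(j)$ for each arrow $\alpha:i\to j$. $S^\Gamma(T,f)$ is the object with $S(T(i))$ at $i$ and $S(f_\alpha)$ on $\alpha$. The quotient $\frac{S^\Gamma(T,f)}{S^\Gamma(T',f)+S^\Gamma(T'',f)}$ is the object with the complex $S(T(i))/(S(T'(i))+S(T''(i)))$ at $i$ and the induced chain maps on arrows. For $(C,g)\in\mathbf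 C\text{-}\mathbf{Rep}\,\Gamma$, $\lim^{\Gamma,\bullet}(C,g)$ is the subcomplex of $\prod_{i\in\Gamma_0}C(i)$ with degree $n$ part $\{(x_i): x_i\in C(i)_n,\ (g_\alpha)_n(x_i)=x_j\text{ for each arrow }\alpha:i\to j\}$. *)

(* Defs.v *)
From HB Require Import structures.
From mathcomp Require Import freeg.
From mathcomp Require Import all_boot all_order all_algebra.
From mathcomp Require Import generic_quotient ring_quotient.
From mathcomp Require Import zify ring.
From mathcomp Require Import all_classical all_reals all_analysis.
Import Order.TTheory GRing.Theory Num.Theory numFieldNormedType.Exports.
Set Implicit Arguments.
Unset Strict Implicit.
Unset Printing Implicit Defensive.
Local Open Scope classical_set_scope.
Local Open Scope quotient_scope.
Local Open Scope ring_scope.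

Definition is_subgroup (V : zmodType) (P : set V) :=
  P 0 /\ forall x y, P x -> P y -> P (x - y).

Section Subgroup.
Variables (V : zmodType) (P : set V) (hP : is_subgroup P).

Definition subgroup_pred of is_subgroup P : {pred V} := fun x => `[< P x >].

Lemma subgroup_predP : zmod_closed (subgroup_pred hP).
Proof.
case: (hP) => P0 PB; split; first exact/asboolP.
by move=> x y /asboolP Px /asboolP Py; apply/asboolP/PB.
Qed.

HB.instance Definition _ :=
  GRing.isZmodClosed.Build V (subgroup_pred hP) subgroup_predP.

Definition subgroup : zmodClosed V := subgroup_pred hP.

Lemma subgroupP x : reflect (P x) (x \in subgroup).
Proof. exact: asboolP. Qed.
End Subgroup.

Section SubgroupType.
Variables (V : zmodType) (I : zmodClosed V).

Definition subz := {x : V | x \in I}.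

HB.instance Definition _ := SubChoice.on subz.
HB.instance Definition _ := [SubChoice_isSubZmodule of subz by <:].
End SubgroupType.

Section SubgroupMap.
Variables (V W : zmodType) (I : zmodClosed V) (J : zmodClosed W).
Variables (f : {additive V -> W}) (hf : forall x, x \in I -> f x \in J).

Definition subz_map (x : subz I) : subz J := exist _ (f (val x)) (hf (valP x)).

Lemma subz_map_additive : zmod_morphism subz_map.
Proof. by move=> x y; apply: val_inj; rewrite /= !raddfB. Qed.

HB.instance Definition _ :=
  GRing.isZmodMorphism.Build (subz I) (subz J) subz_map subz_map_additive.

Definition quot_map of (forall x, x \in I -> f x \in J) :=
  fun x : {ideal_quot I} => \pi_{ideal_quot J} (f (repr x)).

Lemma quot_map_pi x : quot_map hf (\pi_{ideal_quot I} x) = \pi_{ideal_quot J} (f x).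
Proof.
apply/eqP; rewrite /quot_map -Quotient.idealrBE -raddfB; apply: hf.
by rewrite Quotient.idealrBE reprK.
Qed.

Lemma quot_map_additive : zmod_morphism (quot_map hf).
Proof.
by elim/quotW=> x; elim/quotW=> y; rewrite -raddfB !quot_map_pi !raddfB.
Qed.

HB.instance Definition _ :=
  GRing.isZmodMorphism.Build {ideal_quot I} {ideal_quot J} (quot_map hf)
    quot_map_additive.
End SubgroupMap.

Arguments subz_map {V W} I J f hf.
Arguments quot_map {V W} I J f hf.

Section Product.
Variables (I : Type) (M : I -> zmodType).

Definition prodz := forall i, M i.

HB.instance Definition _ := Choice.on prodz.

Let add (x y : prodz) : prodz := fun i => x i + y i.
Let opp (x : prodz) : prodz := fun i => - x i.
Let zero : prodz := fun i => 0.

Fact prodz_addA : associative add.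
Proof. by move=> x y z; apply: functional_extensionality_dep => i; exact: addrA. Qed.
Fact prodz_addC : commutative add.
Proof. by move=> x y; apply: functional_extensionality_dep => i; exact: addrC. Qed.
Fact prodz_add0 : left_id zero add.
Proof. by move=> x; apply: functional_extensionality_dep => i; exact: add0r. Qed.
Fact prodz_addN : left_inverse zero opp add.
Proof. by move=> x; apply: functional_extensionality_dep => i; exact: addNr. Qed.

HB.instance Definition _ :=
  GRing.isZmodule.Build prodz prodz_addA prodz_addC prodz_add0 prodz_addN.
End Product.

Section ProductMap.
Variables (I : Type) (M N : I -> zmodType).
Variable f : forall i, {additive M i -> N i}.

Definition prodz_map (x : prodz M) : prodz N := fun i => f i (x i).

Lemma prodz_map_additive : zmod_morphism prodz_map.
Proof.
move=> x y; apply: functional_extensionality_dep => i; exact: raddfB.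
Qed.

HB.instance Definition _ :=
  GRing.isZmodMorphism.Build (prodz M) (prodz N) prodz_map prodz_map_additive.
End ProductMap.

(* Complexes are graded by the natural numbers; the groups in negative degree
   are zero, in accordance with S_{-1}(X) = 0. The differential [bd C n] is the
   one from degree n+1 to degree n. *)
Record chain_complex := ChainComplex {
  cx :> nat -> zmodType;
  bd : forall n, {additive cx n.+1 -> cx n};
  bdK : forall n x, bd n (bd n.+1 x) = 0
}.

Record cmap (C D : chain_complex) := Cmap {
  cfun :> forall n, {additive C n -> D n};
  cfun_bd : forall n x, cfun n (bd C n x) = bd D n (cfun n.+1 x)
}.

Record subcomplex (C : chain_complex) := Subcomplex {
  scx :> forall n, zmodClosed (C n);
  scx_bd : forall n x, x \in scx n.+1 -> bd C n x \in scx n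
}.

Section ComplexOfSub.
Variables (C : chain_complex) (A : subcomplex C).

Let sbd n : {additive subz (A n.+1) -> subz (A n)} :=
  subz_map (A n.+1) (A n) (bd C n) (@scx_bd C A n).

Lemma sub_bdK n x : sbd n (sbd n.+1 x) = 0.
Proof. by apply: val_inj; rewrite /= bdK. Qed.

Definition sub_cx : chain_complex := ChainComplex sub_bdK.

(* [ideal_quot] is the library's quotient of an abelian group by a subgroup:
   no ring structure is involved. *)
Let qbd n : {additive {ideal_quot A n.+1} -> {ideal_quot A n}} :=
  quot_map (A n.+1) (A n) (bd C n) (@scx_bd C A n).

Lemma quot_bdK n x : qbd n (qbd n.+1 x) = 0.
Proof.
by elim/quotW: x => x; rewrite /qbd /= !quot_map_pi ?bdK ?raddf0.
Qed.

Definition quot_cx : chain_complex := ChainComplex quot_bdK.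
End ComplexOfSub.

Section QuotCmap.
Variables (C D : chain_complex) (A : subcomplex C) (B : subcomplex D) (f : cmap C D).
Hypothesis hf : forall n x, x \in A n -> f n x \in B n.

Let qf n : {additive quot_cx A n -> quot_cx B n} :=
  quot_map (A n) (B n) (f n) (@hf n).

Lemma quot_cmap_bd n x : qf n (bd (quot_cx A) n x) = bd (quot_cx B) n (qf n.+1 x).
Proof.
elim/quotW: x => x; rewrite /qf /= !quot_map_pi ?cfun_bd //.
all: by [exact: scx_bd | exact: hf].
Qed.

Definition quot_cmap : cmap (quot_cx A) (quot_cx B) := Cmap quot_cmap_bd.
End QuotCmap.

Section ImageSum.
Variables (C D : chain_complex).

Section Image.
Variable f : cmap C D.

Lemma im_is_subgroup n : is_subgroup [set y | exists x, f n x = y].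
Proof.
split=> [|_ _ [x <-] [y <-]]; first by exists 0; rewrite raddf0.
by exists (x - y); rewrite raddfB.
Qed.

Lemma im_bd n y : y \in subgroup (im_is_subgroup n.+1) ->
  bd D n y \in subgroup (im_is_subgroup n).
Proof.
by move=> /subgroupP [x <-]; apply/subgroupP; exists (bd C n x); rewrite cfun_bd.
Qed.

Definition im_scx : subcomplex D := Subcomplex im_bd.
End Image.

Variables A B : subcomplex C.

Lemma sum_is_subgroup n :
  is_subgroup [set z | exists x y, [/\ x \in A n, y \in B n & z = x + y]].
Proof.
split=> [|_ _ [x [y [xA yB ->]]] [x' [y' [x'A y'B ->]]]].
  by exists 0, 0; rewrite !rpred0 addr0.
by exists (x - x'), (y - y'); rewrite !rpredB // opprD addrACA.
Qed.

Lemma sum_bd n z : z \in subgroup (sum_is_subgroup n.+1) ->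
  bd C n z \in subgroup (sum_is_subgroup n).
Proof.
move=> /subgroupP [x [y [xA yB ->]]]; apply/subgroupP.
by exists (bd C n x), (bd C n y); rewrite raddfD !scx_bd.
Qed.

Definition sum_scx : subcomplex C := Subcomplex sum_bd.
End ImageSum.

Section ProductComplex.
Variables (I : Type) (C : I -> chain_complex).

Let pbd n : {additive prodz (fun i => C i n.+1) -> prodz (fun i => C i n)} :=
  prodz_map (fun i => bd (C i) n).

Lemma prod_bdK n x : pbd n (pbd n.+1 x) = 0.
Proof. by apply: functional_extensionality_dep => i; exact: bdK. Qed.

Definition prod_cx : chain_complex := ChainComplex prod_bdK.
End ProductComplex.

Section Homology.
Variables (C : chain_complex) (n : nat).

Definition is_cycle : set (C n) :=
  match n return set (C n) with
  | 0%N => setT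
  | m.+1 => [set x | bd C m x = 0]
  end.

Lemma cycle_is_subgroup : is_subgroup is_cycle.
Proof.
rewrite /is_cycle; case: n => [|m]; first by split.
by split=> [|x y /= x0 y0]; rewrite /= ?raddf0 // raddfB x0 y0 subrr.
Qed.

Definition cycles : zmodClosed (C n) := subgroup cycle_is_subgroup.

Lemma boundary_is_subgroup :
  is_subgroup [set z : subz cycles | exists x, bd C n x = val z].
Proof.
split=> [|y z [x xy] [x' x'z]]; first by exists 0; rewrite raddf0.
by exists (x - x'); rewrite !raddfB xy x'z.
Qed.

Definition boundaries : zmodClosed (subz cycles) := subgroup boundary_is_subgroup.

Definition homology : zmodType := {ideal_quot boundaries}.
End Homology.

Section Simplex.
Variable R : realType.

Definition simplex_set n : set 'rV[R]_n.+1 :=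
  [set x | (forall i, 0 <= x ord0 i) /\ \sum_i x ord0 i = 1].

Definition simplex n : topologicalType := set_type (@simplex_set n).

Section Face.
Variables (n : nat) (i : 'I_n.+2).

Definition face_row (x : 'rV[R]_n.+1) : 'rV[R]_n.+2 :=
  \row_j (if unlift i j is Some k then x ord0 k else 0).

Lemma face_rowP x : x \in @simplex_set n -> face_row x \in @simplex_set n.+1.
Proof.
move=> /set_mem [x0 x1]; apply/mem_set; split.
  by move=> j; rewrite mxE; case: unlift.
rewrite (bigD1_ord i) //= mxE unlift_none add0r -[RHS]x1.
by apply: eq_bigr => j _; rewrite mxE liftK.
Qed.

Definition face_fun (x : simplex n) : simplex n.+1 :=
  exist _ (face_row (val x)) (face_rowP (valP x)).
End Face.
End Simplex.

Lemma face_row_continuous (R : realType) n (i : 'I_n.+2) :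
  continuous (@face_row R n i).
Proof.
move=> x A [P xP PA]; exists (fun a k => P a (lift i k)).
  move=> a k; have := xP a (lift i k).
  by rewrite mxE liftK (ord1 a).
move=> y Py; apply: PA => a j; rewrite mxE; case: unliftP => [k ->|->].
  by move: (Py a k); rewrite (ord1 a).
by have := nbhs_singleton (xP a i); rewrite mxE unlift_none.
Qed.

Lemma subtype_continuous (X Y : topologicalType) (A : set Y)
    (f : X -> set_type A) :
  continuous (fun x => val (f x)) -> continuous f.
Proof.
by move=> fc; exact: continuous_comp_initial.
Qed.

Section FaceMap.
Variable R : realType.

Lemma face_continuous n i : continuous (@face_fun R n i).
Proof.
apply: subtype_continuous.
change (continuous (face_row i \o (val : simplex R n -> _))) => x; apply: continuous_comp.
  exact: initial_continuous.
exact: face_row_continuous.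
Qed.

HB.instance Definition _ n i := isContinuous.Build _ _ _ (@face_continuous n i).

Definition face n i : continuousType (simplex R n) (simplex R n.+1) :=
  @face_fun R n i.
End FaceMap.

Definition comp_cts (X Y Z : topologicalType) (g : continuousType Y Z)
  (f : continuousType X Y) : continuousType X Z := g \o f.

Section Lin.
Variables (K : choiceType) (M : lmodType int) (f : K -> M).

HB.instance Definition _ := GRing.isZmodMorphism.Build {freeg K} M (fglift f)
  (lift_is_additive f).

Definition fgl : {additive {freeg K} -> M} := fglift f.
End Lin.

Lemma face_row_lift (R : realType) n (i : 'I_n.+2) x k :
  @face_row R n i x ord0 (lift i k) = x ord0 k.
Proof. by rewrite mxE liftK. Qed.

Lemma face_row_self (R : realType) n (i : 'I_n.+2) x :
  @face_row R n i x ord0 i = 0.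
Proof. by rewrite mxE unlift_none. Qed.

Lemma face_face (R : realType) n (i : 'I_n.+3) (j : 'I_n.+2)
    (i' : 'I_n.+3) (j' : 'I_n.+2) :
  (j < i)%N -> i' = j :> nat -> j' = i.-1 :> nat ->
  @face R n.+1 i \o @face R n j =1 @face R n.+1 i' \o @face R n j'.
Proof.
move=> ji i'E j'E x; apply: val_inj; apply/rowP => k /=.
set f := face_row i _; set g := face_row i' _.
have [k' ->|->] := unliftP i k; last first.
  rewrite [LHS]face_row_self; have -> : i = lift i' j'.
    by apply: val_inj; rewrite /= /bump i'E j'E; lia.
  by rewrite face_row_lift face_row_self.
rewrite face_row_lift; have [l ->|->] := unliftP j k'.
  have -> : lift i (lift j l) = lift i' (lift j' l).
    by apply: val_inj; rewrite /= /bump i'E j'E; lia.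
  by rewrite !face_row_lift.
have -> : lift i j = i' by apply: val_inj; rewrite /= /bump i'E; lia.
by rewrite !face_row_self.
Qed.

Section SingularComplex.
Variables (R : realType) (X : topologicalType).

Definition sing n : zmodType := {freeg (continuousType (simplex R n) X)}.

Definition sing_bd n : {additive sing n.+1 -> sing n} :=
  fgl (fun s : continuousType (simplex R n.+1) X =>
    \sum_(i < n.+2) << (-1) ^+ i *g comp_cts s (face R i) >> : sing n).

Lemma sing_bdU n (c : int) s : sing_bd n << c *g s >> =
  \sum_(i < n.+2) << c * (-1) ^+ i *g comp_cts s (face R i) >>.
Proof.
rewrite /= liftU scaler_sumr; apply: eq_bigr => i _.
apply/eqP/freeg_eqP => t; by rewrite coeffZ !coeffU mulrA.
Qed.

Lemma sing_bdK n x : sing_bd n (sing_bd n.+1 x) = 0.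
Proof.
rewrite -[x]freeg_sumE !raddf_sum big1 // => s _.
rewrite sing_bdU raddf_sum; set c := coeff s x.
under eq_bigr do rewrite sing_bdU.
rewrite pair_bigA (bigID (fun p : 'I_n.+3 * 'I_n.+2 => (p.2 < p.1)%N)) /=.
set A := (X in X + _); set B := (X in _ + X); suff -> : A = - B by rewrite addNr.
rewrite /A /B -sumrN.
pose h (p : 'I_n.+3 * 'I_n.+2) : 'I_n.+3 * 'I_n.+2 := (inord p.2, inord p.1.-1).
pose h' (p : 'I_n.+3 * 'I_n.+2) : 'I_n.+3 * 'I_n.+2 := (inord p.2.+1, inord p.1).
have lt3 (p : 'I_n.+3 * 'I_n.+2) : (p.1 < n.+3)%N by exact: ltn_ord.
have lt2 (p : 'I_n.+3 * 'I_n.+2) : (p.2 < n.+2)%N by exact: ltn_ord.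
have hK (p : 'I_n.+3 * 'I_n.+2) : (p.2 < p.1)%N -> h' (h p) = p.
  have := lt3 p; have := lt2 p; case: p => i j /= jn im ji.
  have e1 : (inord i.-1 : 'I_n.+2) = i.-1 :> nat by rewrite inordK //; lia.
  have e2 : (inord j : 'I_n.+3) = j :> nat by rewrite inordK //; lia.
  by congr pair; apply: val_inj; rewrite /= ?e1 ?e2 inordK //; lia.
have hK' (p : 'I_n.+3 * 'I_n.+2) : (p.1 <= p.2)%N -> h (h' p) = p.
  have := lt3 p; have := lt2 p; case: p => i j /= jn im ij.
  have e1 : (inord j.+1 : 'I_n.+3) = j.+1 :> nat by rewrite inordK //; lia.
  have e2 : (inord i : 'I_n.+2) = i :> nat by rewrite inordK //; lia.
  by congr pair; apply: val_inj; rewrite /= ?e1 ?e2 inordK //; lia.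
rewrite (reindex_onto h' h hK).
have e1 (j : 'I_n.+2) : (inord j.+1 : 'I_n.+3) = j.+1 :> nat.
  by rewrite inordK //; have := ltn_ord j; lia.
have condE (i : 'I_n.+3) (j : 'I_n.+2) :
    ((h' (i, j)).2 < (h' (i, j)).1)%N && (h (h' (i, j)) == (i, j)) = (i <= j)%N.
  apply/andP/idP => [[/= + /eqP [/(congr1 val) /= hi _]]|/= ij].
    have lti := ltn_ord (inord i : 'I_n.+2).
    by move: hi; rewrite e1 /= inordK => [->|]; [rewrite ltnS | exact: ltnW].
  split; last by rewrite hK'.
  by rewrite e1 inordK //; have := ltn_ord j; lia.
apply: eq_big => [[i j]|[i j]]; first by rewrite condE -leqNgt.
rewrite condE => ij; have jn := ltn_ord j.
have e3 : (inord i : 'I_n.+2) = i :> nat by rewrite inordK //; lia.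
rewrite /= e1 e3 freegUN; congr (Freeg [:: (_, _)]).
  by rewrite exprS; ring.
apply/continuousEP => y /=; congr (s _).
by apply: face_face; rewrite /= ?e1 ?e3 //; lia.
Qed.
End SingularComplex.

Lemma comp_ctsA (W X Y Z : topologicalType) (h : continuousType Y Z)
    (g : continuousType X Y) (f : continuousType W X) :
  comp_cts (comp_cts h g) f = comp_cts h (comp_cts g f).
Proof. exact/continuousEP. Qed.

Definition singular (R : realType) (X : topologicalType) : chain_complex :=
  ChainComplex (@sing_bdK R X).

Section SingularMap.
Variables (R : realType) (X Y : topologicalType) (f : continuousType X Y).

Definition sing_fun n : {additive sing R X n -> sing R Y n} :=
  fgl (fun s : continuousType (simplex R n) X =>
    << comp_cts f s >> : sing R Y n).

Lemma sing_funU n (c : int) s : sing_fun n << c *g s >> = << c *g comp_cts f s >>.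
Proof.
rewrite /= liftU; apply/eqP/freeg_eqP => t.
by rewrite coeffZ !coeffU mul1r.
Qed.

Lemma sing_fun_bd n x :
  sing_fun n (@sing_bd R X n x) = @sing_bd R Y n (sing_fun n.+1 x).
Proof.
rewrite -[x]freeg_sumE !raddf_sum; apply: eq_bigr => s _.
rewrite sing_funU !sing_bdU raddf_sum.
by refine (eq_bigr _ _) => i _; rewrite sing_funU comp_ctsA.
Qed.

Definition sing_cmap : cmap (singular R X) (singular R Y) :=
  @Cmap (singular R X) (singular R Y) sing_fun sing_fun_bd.
End SingularMap.

Lemma sing_fun_comp (R : realType) (X Y Z : topologicalType)
    (g : continuousType Y Z) (f : continuousType X Y) n x :
  sing_fun R (comp_cts g f) n x = sing_fun R g n (sing_fun R f n x).
Proof.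
rewrite -[x]freeg_sumE !raddf_sum; apply: eq_bigr => s _.
by rewrite !sing_funU comp_ctsA.
Qed.

Record quiver := Quiver {
  vertex : Type;
  arrow : Type;
  source : arrow -> vertex;
  target : arrow -> vertex
}.

Section Representations.
Variable G : quiver.

Record toprep := Toprep {
  tobj :> vertex G -> topologicalType;
  tarr : forall a : arrow G, continuousType (tobj (source a)) (tobj (target a))
}.

Record crep := Crep {
  cobj :> vertex G -> chain_complex;
  carr : forall a : arrow G, cmap (cobj (source a)) (cobj (target a))
}.

Record crep_map (X Y : crep) := CrepMap {
  crfun :> forall i, cmap (X i) (Y i);
  crfun_arr : forall a n x,
    crfun (target a) n (carr X a n x) = carr Y a n (crfun (source a) n x)
}.

Record subcrep (X : crep) := Subcrep {
  sobj :> forall i, subcomplex (X i);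
  sobj_arr : forall a n x,
    x \in sobj (source a) n -> carr X a n x \in sobj (target a) n
}.

Section ImageRep.
Variables (X Y : crep) (f : crep_map X Y).

Lemma im_arr a n y : y \in im_scx (f (source a)) n ->
  carr Y a n y \in im_scx (f (target a)) n.
Proof.
by move=> /subgroupP [x <-]; apply/subgroupP; exists (carr X a n x); rewrite crfun_arr.
Qed.

Definition im_subcrep : subcrep Y := @Subcrep Y (fun i => im_scx (f i)) im_arr.
End ImageRep.

Section SumQuotRep.
Variables (X : crep) (A B : subcrep X).

Lemma sum_arr a n z : z \in sum_scx (A (source a)) (B (source a)) n ->
  carr X a n z \in sum_scx (A (target a)) (B (target a)) n.
Proof.
move=> /subgroupP [x [y [xA yB ->]]]; apply/subgroupP.
by exists (carr X a n x), (carr X a n y); rewrite raddfD !sobj_arr.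
Qed.

Definition sum_subcrep : subcrep X :=
  @Subcrep X (fun i => sum_scx (A i) (B i)) sum_arr.

Definition quot_crep : crep :=
  @Crep (fun i => quot_cx (A i)) (fun a => quot_cmap (@sobj_arr X A a)).
End SumQuotRep.

Section Limit.
Variable X : crep.

Lemma lim_is_subgroup n : is_subgroup
  [set x : prod_cx X n | forall a, carr X a n (x (source a)) = x (target a)].
Proof.
split=> [a|x y hx hy a]; first exact: raddf0.
by rewrite [LHS]raddfB hx hy.
Qed.

Lemma lim_bd n x : x \in subgroup (lim_is_subgroup n.+1) ->
  bd (prod_cx X) n x \in subgroup (lim_is_subgroup n).
Proof.
move=> /subgroupP hx; apply/subgroupP => a /=.
by rewrite /prodz_map cfun_bd hx.
Qed.

Definition lim_scx : subcomplex (prod_cx X) := Subcomplex lim_bd.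

Definition lim_crep : chain_complex := sub_cx lim_scx.
End Limit.

Definition sing_crep (R : realType) (T : toprep) : crep :=
  @Crep (fun i => singular R (T i)) (fun a => sing_cmap R (tarr T a)).

Section Subspaces.
Variables (R : realType) (T : toprep) (A : forall i, set (T i)).
Hypothesis hA : forall a, tarr T a @` @A (source a) `<=` @A (target a).

Definition restr_fun a (x : @A (source a)) : @A (target a) :=
  exist _ (tarr T a (val x)) (mem_set (hA (imageP _ (set_valP x)))).

Lemma restr_continuous a : continuous (@restr_fun a).
Proof.
apply: subtype_continuous.
change (continuous (tarr T a \o (val : @A (source a) -> _))) => x.
apply: continuous_comp; first exact: initial_continuous.
exact: cts_fun.
Qed.

HB.instance Definition _ a := isContinuous.Build _ _ _ (@restr_continuous a).

Definition subtop : toprep :=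
  @Toprep (fun i => set_type (@A i)) (fun a => @restr_fun a).

Definition incl_fun i (x : @A i) : T i := val x.

Lemma incl_continuous i : continuous (@incl_fun i).
Proof. exact: initial_continuous. Qed.

HB.instance Definition _ i := isContinuous.Build _ _ _ (@incl_continuous i).

Definition incl i : continuousType (subtop i) (T i) := @incl_fun i.

Lemma incl_arr a n (x : sing_crep R subtop (source a) n) :
  sing_cmap R (incl (target a)) n (carr (sing_crep R subtop) a n x) =
  carr (sing_crep R T) a n (sing_cmap R (incl (source a)) n x).
Proof.
rewrite /= -!sing_fun_comp; congr (sing_fun R _ n x).
exact/continuousEP.
Qed.

Definition sing_incl : crep_map (sing_crep R subtop) (sing_crep R T) :=
  @CrepMap (sing_crep R subtop) (sing_crep R T)
    (fun i => sing_cmap R (incl i)) incl_arr.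

Definition sing_subcrep : subcrep (sing_crep R T) :=
  im_subcrep sing_incl.
End Subspaces.
End Representations.

(* Main.v *)
Require Import Defs.
From HB Require Import structures.
From mathcomp Require Import freeg.
From mathcomp Require Import all_boot all_order all_algebra.
From mathcomp Require Import generic_quotient ring_quotient.
From mathcomp Require Import lra.
From mathcomp Require Import all_classical all_reals all_analysis.
Import Order.TTheory GRing.Theory Num.Theory numFieldNormedType.Exports.
Set Implicit Arguments.
Unset Strict Implicit.
Unset Printing Implicit Defensive.
Local Open Scope classical_set_scope.
Local Open Scope quotient_scope.
Local Open Scope ring_scope.

(** Let Q(i) be the quotient of S(T(i)) by the chains that are sums of a chain
    of T'(i) and a chain of T''(i), which are called small below.

    In degree 0 nothing is left: a 0-simplex is a point, and a point lies in
    T'(i) or in T''(i). So Q(i)_0 = 0, and the limit vanishes in degree 0.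

    In degree 1 the boundary map from degree 2 has a right inverse that commutes
    with the arrows, and such an inverse passes to the limit. To build it, let
    Sd cut a path into its two halves, and let D precompose a path with the map
    that collapses the triangle onto an edge, the middle vertex going to the
    midpoint. Two faces of the collapsed triangle are the two halves and the
    third one is the path itself, so that bd (D x) = Sd x - x holds exactly
    ([fold_bd]). Hence
      y = - (D x + D (Sd x) + ... + D (Sd^(N-1) x))
    satisfies bd y = x - Sd^N x, and it remains to kill Sd^N x. By the Lebesgue
    number lemma ([lebesgue_number_edge]) every path becomes small after enough
    halvings, so every element of Q(i)_1 is killed by some power of Sd
    ([iter_subdiv_eventually_small]).

    The required N depends on the chain, hence on the vertex, and it may be
    unbounded along the quiver. This does no harm: D and Sd preserve small
    chains, so in Q(i) the terms of the sum from the N-th one on are zero, and y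
    is the value at x of the infinite sum of the - D (Sd^k x). That infinite sum
    commutes with the arrows because D and Sd do. [lim_homologyS_eq0] is this
    argument for an arbitrary representation. *)

(** * Vanishing of the homology of a limit *)

Section IterAdditive.
Variables (V : zmodType) (f : {additive V -> V}) (N : nat).

Lemma iter_is_additive : zmod_morphism (iter N f).
Proof. by move=> x y; elim: N => //= m ->; rewrite raddfB. Qed.

HB.instance Definition _ :=
  GRing.isZmodMorphism.Build V V (iter N f) iter_is_additive.
End IterAdditive.

Lemma homology_eq0 (C : chain_complex) n :
  (forall z : C n, is_cycle z -> exists x, bd C n x = z) ->
  forall h : homology C n, h = 0.
Proof.
move=> Hz; elim/quotW => z; rewrite -[0](raddf0 (\pi_(homology C n))).
apply/eqP; rewrite -Quotient.idealrBE subr0; apply/subgroupP.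
apply: Hz; case: z => z zP /=.
exact: (elimT (subgroupP (cycle_is_subgroup _ _) _) zP).
Qed.

(** A locally nilpotent [s] with [bd \o d = s - id] makes [id - s] invertible by
    its Neumann series, and [bd] surjective onto degree [n]. *)
Section Neumann.
Variables (C : chain_complex) (n : nat).
Variables (s : {additive C n -> C n}) (d : {additive C n -> C n.+1}).

Definition neumann N x := \sum_(k < N) d (iter k s x).

Lemma neumann_bd N x : (forall x, bd C n (d x) = s x - x) ->
  bd C n (neumann N x) = iter N s x - x.
Proof.
move=> sd; rewrite /neumann raddf_sum; elim: N => [|N IH].
  by rewrite big_ord0 subrr.
by rewrite big_ord_recr IH sd /= addrC addrA subrK.
Qed.

(** Truncating late enough gives the value of the whole series; this is what
    makes truncations at different vertices compatible. *)
Lemma neumann_stable N M x :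
  iter N s x = 0 -> iter M s x = 0 -> neumann N x = neumann M x.
Proof.
wlog le_NM : N M / (N <= M)%N.
  move=> H; case: (leqP N M) => [/H //|/ltnW /H {}H N0 M0]; exact/esym/H.
move=> N0 _; rewrite -(subnKC le_NM); elim: (M - N)%N => [|k IH].
  by rewrite addn0.
rewrite addnS {1}IH /neumann big_ord_recr /= addnC iterD N0.
by rewrite [iter k s 0]raddf0 raddf0 addr0.
Qed.
End Neumann.

Section LimitVanishing.
Variables (G : quiver) (X : crep G) (n : nat).
Variables (s : forall i, {additive X i n.+1 -> X i n.+1})
  (d : forall i, {additive X i n.+1 -> X i n.+2}).
Hypothesis sd : forall i x, bd (X i) n.+1 (d i x) = s i x - x.
Hypothesis s_arr : forall a x,
  s (target a) (carr X a n.+1 x) = carr X a n.+1 (s (source a) x).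
Hypothesis d_arr : forall a x,
  d (target a) (carr X a n.+1 x) = carr X a n.+2 (d (source a) x).
Hypothesis s_nil : forall i x, exists N, iter N (s i) x = 0.

Lemma iter_arr N a x : iter N (s (target a)) (carr X a n.+1 x) =
  carr X a n.+1 (iter N (s (source a)) x).
Proof. by elim: N => //= N ->; rewrite s_arr. Qed.

Lemma neumann_arr N a x : neumann (s (target a)) (d (target a)) N
    (carr X a n.+1 x) =
  carr X a n.+2 (neumann (s (source a)) (d (source a)) N x).
Proof.
rewrite /neumann raddf_sum; apply: eq_bigr => k _.
by rewrite -d_arr iter_arr.
Qed.

(** At each vertex the Neumann series gives a primitive of the coordinate of a
    cycle. The truncation index is chosen vertex by vertex, but the truncated
    sums do not depend on it, so that the primitives still form an element of
    the limit. *)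
Lemma lim_homologyS_eq0 (h : homology (lim_crep X) n.+1) : h = 0.
Proof.
apply: homology_eq0 h => /= -[x xP] _.
have /subgroupP /= x_arr := xP.
have [N NP] := choice (fun i => s_nil (x i)).
pose y : prod_cx X n.+2 := fun i => - neumann (s i) (d i) (N i) (x i).
have yP : y \in lim_scx X n.+2.
  apply/subgroupP => a; rewrite /y raddfN -neumann_arr x_arr; congr (- _).
  apply: neumann_stable; last exact: NP.
  by rewrite -x_arr iter_arr NP raddf0.
exists (exist _ y yP); apply: val_inj; rewrite /=.
apply: functional_extensionality_dep => i /=.
by rewrite /prodz_map /y raddfN (neumann_bd _ _ (@sd i)) NP sub0r opprK.
Qed.
End LimitVanishing.

(** * Barycentric coordinates and the edge *)

Lemma rV_continuous (K : realType) (X : topologicalType) n (f : X -> 'rV[K]_n) :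
  (forall j, continuous (fun x => f x ord0 j)) -> continuous f.
Proof.
move=> fc x A [P xP PA].
have : \forall y \near x, forall j, P ord0 j (f y ord0 j).
  by apply: filter_forall => j; apply: fc; exact: xP.
by apply: filterS => y yP; apply: PA => i j; rewrite (ord1 i).
Qed.

Section Barycentric.
Variables (R : realType) (n : nat).

Definition bary (i : 'I_n.+1) (x : simplex R n) : R := val x ord0 i.

Lemma bary_continuous i : continuous (bary i).
Proof.
change (continuous ((fun M : 'rV[R]_n.+1 => M ord0 i) \o
  (val : simplex R n -> _))) => x.
apply: continuous_comp; first exact: initial_continuous.
exact: coord_continuous.
Qed.

Lemma bary_ge0 i x : 0 <= bary i x.
Proof. by have /set_mem [x0 _] := valP x; exact: x0. Qed.

Lemma sum_bary x : \sum_i bary i x = 1.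
Proof. by have /set_mem [] := valP x. Qed.

Lemma simplex_eqP x y : (forall i, bary i x = bary i y) -> x = y.
Proof. by move=> xy; apply: val_inj; apply/rowP => i; exact: xy. Qed.
End Barycentric.

Section Edge.
Variable R : realType.

Lemma bary_edge (x : simplex R 1) : bary ord0 x = 1 - bary ord_max x.
Proof.
rewrite -(sum_bary x) big_ord_recr big_ord1 /= addrK.
by congr bary; apply: val_inj.
Qed.

(** The edge is parametrised by the whole real line, constantly outside [0, 1],
    so that a path is a continuous function on the line and the compactness of
    [0, 1] can be applied to it. *)
Definition clamp (t : R) : R := Num.max 0 (Num.min 1 t).

Definition edge_row (t : R) : 'rV[R]_2 :=
  \row_j (if j == ord0 then 1 - t else t).

Lemma edge_rowP t : 0 <= t <= 1 -> edge_row t \in @simplex_set R 1.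
Proof.
move=> /andP[t0 t1]; apply/mem_set; split.
  by move=> j; rewrite mxE; case: eqP => _ //; rewrite subr_ge0.
by rewrite big_ord_recr big_ord1 !mxE /= subrK.
Qed.

Lemma clampP t : 0 <= clamp t <= 1.
Proof. by rewrite /clamp le_max lexx /= ge_max ler01 ge_min lexx. Qed.

Lemma clamp_id t : 0 <= t <= 1 -> clamp t = t.
Proof. by move=> /andP[t0 t1]; rewrite /clamp (min_idPr t1) (max_idPr t0). Qed.

Lemma clamp_continuous : continuous clamp.
Proof.
move=> t; apply: continuous_max; first exact: cst_continuous.
by apply: continuous_min; [exact: cst_continuous | exact: id].
Qed.

Definition edge (t : R) : simplex R 1 :=
  exist _ (edge_row (clamp t)) (edge_rowP (clampP t)).

Lemma edge_continuous : continuous edge.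
Proof.
apply/subtype_continuous/rV_continuous => j /=.
rewrite (_ : (fun t => _) =
    if j == ord0 then (fun t => 1 - clamp t) else clamp); last first.
  by apply: funext => t; rewrite mxE; case: ifP.
case: ifP => _ t; last exact: clamp_continuous.
by apply: continuousB; [exact: cst_continuous | exact: clamp_continuous].
Qed.

Lemma edge_bary x : edge (bary ord_max x) = x.
Proof.
have t01 : 0 <= bary ord_max x <= 1.
  by rewrite bary_ge0 -subr_ge0 -bary_edge bary_ge0.
apply: simplex_eqP => i; rewrite {1}/bary /= mxE clamp_id //.
case: eqP => [->|/eqP i0]; first by rewrite bary_edge.
by congr bary; apply: val_inj; case: i i0 => -[|[]].
Qed.
End Edge.

(** * Halving a path *)

Section Fold.
Variable R : realType.

(** The affine map from the triangle to the edge that sends its three vertices to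
    the start, the midpoint and the end of the edge. *)
Definition fold_row (x : 'rV[R]_3) : 'rV[R]_2 :=
  let mid := x ord0 (lift ord0 ord0) / 2 in
  \row_j (if j == ord0 then x ord0 ord0 + mid else mid + x ord0 ord_max).

Lemma fold_rowP x : x \in @simplex_set R 2 -> fold_row x \in @simplex_set R 1.
Proof.
move=> /set_mem [x0 x1]; apply/mem_set; split.
  move=> j; rewrite mxE.
  by case: eqP => _; rewrite addr_ge0 // mulr_ge0 // invr_ge0.
rewrite -x1 !big_ord_recl !big_ord0 !mxE /=.
have -> : lift ord0 (lift ord0 ord0) = ord_max :> 'I_3 by exact: val_inj.
lra.
Qed.

Definition fold_fun (x : simplex R 2) : simplex R 1 :=
  exist _ (fold_row (val x)) (fold_rowP (valP x)).

Lemma fold_continuous : continuous fold_fun.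
Proof.
have mid_cts : continuous (fun x : simplex R 2 => bary (lift ord0 ord0) x / 2).
  move=> x; apply: continuousM; last exact: cst_continuous.
  exact: bary_continuous.
have left_cts : continuous (fun x : simplex R 2 =>
    bary ord0 x + bary (lift ord0 ord0) x / 2).
  by move=> x; exact: (continuousD (@bary_continuous R 2 ord0 x) (mid_cts x)).
have right_cts : continuous (fun x : simplex R 2 =>
    bary (lift ord0 ord0) x / 2 + bary ord_max x).
  by move=> x; exact: (continuousD (mid_cts x) (@bary_continuous R 2 _ x)).
apply/subtype_continuous/rV_continuous => j /=.
rewrite (_ : (fun x => _) =
  if j == ord0 then fun x => bary ord0 x + bary (lift ord0 ord0) x / 2
  else fun x => bary (lift ord0 ord0) x / 2 + bary ord_max x).
  by case: ifP.
by apply: funext => x; rewrite mxE; case: ifP.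
Qed.

HB.instance Definition _ := isContinuous.Build _ _ _ fold_continuous.

Definition fold : continuousType (simplex R 2) (simplex R 1) := fold_fun.

(** The halves are taken as faces of the fold, so that the boundary formula
    [fold_bd] needs no comparison between two descriptions of a half. *)
Definition left_half := comp_cts fold (face R ord_max).
Definition right_half := comp_cts fold (face R ord0).

Lemma bary_left x : bary ord_max (left_half x) = bary ord_max x / 2.
Proof.
rewrite {1}/bary /= /fold_row mxE /= face_row_self addr0.
rewrite (_ : lift ord0 ord0 = lift ord_max ord_max) ?face_row_lift //.
exact: val_inj.
Qed.

Lemma bary_right x : bary ord_max (right_half x) = (1 + bary ord_max x) / 2.
Proof.
rewrite {1}/bary /= /fold_row mxE /=.
rewrite (_ : ord_max = lift ord0 ord_max) ?face_row_lift; last exact: val_inj.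
rewrite -[X in X / 2 + _]/(bary ord0 x) -[X in _ + X]/(bary ord_max x).
rewrite bary_edge; lra.
Qed.

Lemma fold_middle : comp_cts fold (face R (lift ord0 ord0)) =1 id.
Proof.
move=> x; apply: simplex_eqP => i.
rewrite {1}/bary /= /fold_row mxE face_row_self mul0r addr0 add0r.
have -> : ord0 = lift (lift ord0 ord0) ord0 :> 'I_3 by exact: val_inj.
have -> : ord_max = lift (lift ord0 ord0) ord_max :> 'I_3 by exact: val_inj.
rewrite !face_row_lift; case: eqP => [->//|/eqP i0].
by congr bary; apply: val_inj; case: i i0 => -[|[]].
Qed.
End Fold.

(** * The natural operators on chains *)

Section Precomposition.
Variables (R : realType) (m n : nat).
Variable p : continuousType (simplex R m) (simplex R n).

Definition precomp (X : topologicalType) : {additive sing R X n -> sing R X m} :=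
  fgl (fun s : continuousType (simplex R n) X => << comp_cts s p >> : sing R X m).

Lemma precompU X (c : int) s : precomp X << c *g s >> = << c *g comp_cts s p >>.
Proof.
rewrite /= liftU; apply/eqP/freeg_eqP => t.
by rewrite coeffZ !coeffU mul1r.
Qed.

Lemma precomp_sing_fun (X Y : topologicalType) (f : continuousType X Y) x :
  precomp Y (sing_fun R f n x) = sing_fun R f m (precomp X x).
Proof.
rewrite -[x]freeg_sumE !raddf_sum; apply: eq_bigr => s _.
by rewrite precompU !sing_funU precompU comp_ctsA.
Qed.
End Precomposition.

Lemma freeg_subgroup_ind (K : choiceType) (P : set {freeg K}) :
  is_subgroup P -> (forall s, P << s >>) -> forall x, P x.
Proof.
move=> P_subgroup PU x; apply/(subgroupP P_subgroup); rewrite -[x]freeg_sumE.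
apply: rpred_sum => s _; rewrite -[coeff s x]intz -freegU_mulz.
by apply: rpredMz; apply/subgroupP.
Qed.

Section Subdivision.
Variables (R : realType).

Definition subdiv (X : topologicalType) : {additive sing R X 1 -> sing R X 1} :=
  (precomp (left_half R) X \+ precomp (right_half R) X)%R.

Lemma subdivU X (c : int) s : subdiv X << c *g s >> =
  << c *g comp_cts s (left_half R) >> + << c *g comp_cts s (right_half R) >>.
Proof. by rewrite -!precompU. Qed.

(** Face 0 of the fold is the right half, face 2 the left half, and face 1, the
    only one with a negative sign, is the identity of the edge. *)
Lemma fold_bd X x :
  @sing_bd R X 1 (precomp (fold R) X x) = subdiv X x - x.
Proof.
apply: (canRL (addrK x)).
rewrite -[x]freeg_sumE !raddf_sum -big_split; apply: eq_bigr => s _.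
rewrite subdivU precompU sing_bdU /=.
rewrite !big_ord_recl big_ord0 addr0 /= expr0 expr1 sqrrN expr1n mulrN1 !mulr1.
rewrite !comp_ctsA -freegUN.
have -> : comp_cts s (comp_cts (fold R) (face R (lift ord0 ord0))) = s.
  by apply/continuousEP => y /=; congr (s _); exact: fold_middle.
have -> : lift ord0 (lift ord0 ord0) = ord_max :> 'I_3 by exact: val_inj.
by rewrite addrC [X in _ + X]addrCA addNKr addrC.
Qed.

Lemma subdiv_sing_fun (X Y : topologicalType) (f : continuousType X Y) x :
  subdiv Y (sing_fun R f 1 x) = sing_fun R f 1 (subdiv X x).
Proof. by rewrite /= -!/(precomp _ _) !precomp_sing_fun raddfD. Qed.

(** Small chains for two maps into [X] in place of two subspaces: operators given
    by precomposition preserve them because they commute with the maps. *)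
Section Small.
Variables (X Y Z : topologicalType).
Variables (f : continuousType Y X) (g : continuousType Z X).

Definition small := sum_scx (im_scx (sing_cmap R f)) (im_scx (sing_cmap R g)).

Lemma precomp_small m n (p : continuousType (simplex R m) (simplex R n)) x :
  x \in small n -> precomp p X x \in small m.
Proof.
move=> /subgroupP [_ [_ [/subgroupP[y <-] /subgroupP[z <-] ->]]].
rewrite raddfD; apply/subgroupP.
exists (sing_fun R f m (precomp p Y y)), (sing_fun R g m (precomp p Z z)).
split; first by apply/subgroupP; eexists.
  by apply/subgroupP; eexists.
by rewrite -!precomp_sing_fun.
Qed.

Lemma subdiv_small x : x \in small 1 -> subdiv X x \in small 1.
Proof. by move=> xS; apply: rpredD; exact: precomp_small. Qed.

Lemma iter_subdiv_small N M x : (N <= M)%N ->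
  iter N (subdiv X) x \in small 1 -> iter M (subdiv X) x \in small 1.
Proof.
move=> /subnK <- xS; rewrite iterD.
by elim: (M - N)%N => //= k; exact: subdiv_small.
Qed.

End Small.
End Subdivision.

(** * Every path becomes small *)

Section Corestriction.
Variables (X Y : topologicalType) (A : set Y) (s : continuousType X Y).
Hypothesis sA : forall x, A (s x).

Definition corestr_fun (x : X) : A := exist _ (s x) (mem_set (sA x)).

Lemma corestr_continuous : continuous corestr_fun.
Proof. by apply: subtype_continuous; exact: cts_fun. Qed.

HB.instance Definition _ := isContinuous.Build _ _ _ corestr_continuous.

Definition corestr : continuousType X (set_type A) := corestr_fun.
End Corestriction.

Section Lebesgue.
Variables (R : realType) (X : topologicalType) (A B : set X).
Hypothesis AB : A° `|` B° = [set: X].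

Definition near_sub (s : simplex R 1 -> X) (C : set X) (N : nat)
    (x : simplex R 1) :=
  forall y, `|bary ord_max x - bary ord_max y| <= 2^-1 ^+ N -> C (s y).

(** The Lebesgue number lemma for paths, with the number a power of one half,
    since halving a path [N] times divides lengths by [2 ^ N]. Each time has a
    neighbourhood with a common such number; compactness of the interval makes
    the number uniform. *)
Lemma lebesgue_number_edge (s : continuousType (simplex R 1) X) :
  exists N, forall x, near_sub s A N x \/ near_sub s B N x.
Proof.
pose g := s \o @edge R.
have g_cts : continuous g.
  move=> t; apply: continuous_comp; first exact: edge_continuous.
  exact: cts_fun.
pose P N t := (forall u, `|t - u| <= 2^-1 ^+ N -> A (g u)) \/
              (forall u, `|t - u| <= 2^-1 ^+ N -> B (g u)).
have local t C : C° (g t) -> \forall t' \near t & N \near \oo,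
    forall u, `|t' - u| <= 2^-1 ^+ N -> C (g u).
  move=> /(g_cts t) /nbhs_ballP [e /= e0 eC].
  (* half of the radius for moving the centre, half for the Lebesgue number *)
  have e2 : 0 < e / 2 by rewrite divr_gt0.
  exists (ball t (e / 2), [set N | 2^-1 ^+ N < e / 2]) => /=.
    split; first exact: nbhsx_ballx.
    have := near_infty_natSinv_expn_lt (PosNum e2).
    by apply: filterS => N /=; rewrite div1r exprVn.
  move=> [t' N] /= [tt' Ne] u t'u; apply: eC; rewrite /ball /=.
  rewrite -[t - u](subrKA t') (le_lt_trans (ler_normD _ _)) //.
  by rewrite [e]splitr ltrD // (le_lt_trans t'u).
have /compact_near_coveringP/(_ _ \oo P _) := @segment_compact R 0 1.
have P_near (t : R) : `[0, 1]%classic t ->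
    \forall t' \near t & N \near \oo, P N t'.
  move=> _; have : (A° `|` B°) (g t) by rewrite AB.
  by case=> /local; apply: filterS => -[t' N] /= H; [left | right].
move=> /(_ P_near) [N _ /(_ N (leqnn N)) NP]; exists N => x.
have x01 : `[0, 1]%classic (bary ord_max x).
  by rewrite /= in_itv /= bary_ge0 -subr_ge0 -bary_edge bary_ge0.
case: (NP _ x01) => H; [left | right] => y xy.
  by rewrite -(edge_bary y); exact: H.
by rewrite -(edge_bary y); exact: H.
Qed.
End Lebesgue.

Section SmallSimplices.
Variables (R : realType) (G : quiver) (T : toprep G).
Variables T1 T2 : forall i : vertex G, set (T i).
Arguments T1 : clear implicits.
Arguments T2 : clear implicits.
Hypothesis cover : forall i, (T1 i)° `|` (T2 i)° = [set: T i].
Hypothesis fT1 : forall a : arrow G, tarr T a @` T1 (source a) `<=` T1 (target a).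
Hypothesis fT2 : forall a : arrow G, tarr T a @` T2 (source a) `<=` T2 (target a).

Let sml (i : vertex G) := small R (Defs.incl fT1 i) (Defs.incl fT2 i).

Lemma sing_incl_im (A : forall i, set (T i))
    (fA : forall a, tarr T a @` @A (source a) `<=` @A (target a)) i n
    (s : continuousType (simplex R n) (T i)) :
  (forall x, @A i (s x)) -> << s >> \in im_scx (sing_cmap R (Defs.incl fA i)) n.
Proof.
move=> sA; apply/subgroupP; exists << corestr sA >>.
by rewrite sing_funU; congr << _ >>; apply/continuousEP.
Qed.

Lemma simplex_small i n (s : continuousType (simplex R n) (T i)) :
  (forall x, T1 i (s x)) \/ (forall x, T2 i (s x)) -> << s >> \in sml i n.
Proof.
move=> sT; apply/subgroupP; case: sT => /sing_incl_im sT.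
  by exists << s >>, 0; rewrite addr0 rpred0.
by exists 0, << s >>; rewrite add0r rpred0.
Qed.

(** The standard 0-simplex has a single point, so a 0-simplex of [T i] is a point
    of the covered space. *)
Lemma sing0_small i (x : sing R (T i) 0) : x \in sml i 0.
Proof.
move: x; apply: freeg_subgroup_ind => [|s].
  by split=> [|x y xS yS]; rewrite ?rpred0 ?rpredB.
apply: simplex_small.
have pt (x y : simplex R 0) : x = y.
  apply: simplex_eqP => j; rewrite (ord1 j).
  by have := sum_bary x; have := sum_bary y; rewrite !big_ord1 => -> ->.
have [x0|no_pt] := pselect (exists x : simplex R 0, True); last first.
  by left=> x; case: no_pt; exists x.
have [x1 _] := x0.
have : ((T1 i)° `|` (T2 i)°) (s x1) by rewrite cover.
by case=> /interior_subset sT; [left | right] => y; rewrite (pt y x1).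
Qed.

(** Precomposing with a half doubles the Lebesgue number of a path, so the
    induction on [N] ends with a path whose Lebesgue number is the length of the
    whole edge: such a path lies in one of the two subspaces. *)
Lemma iter_subdivU_small i N (s : continuousType (simplex R 1) (T i)) :
  (forall x, near_sub s (T1 i) N x \/ near_sub s (T2 i) N x) ->
  iter N (subdiv R (T i)) << s >> \in sml i 1.
Proof.
elim: N s => [|N IH] s sN.
  apply: simplex_small.
  have near_all C x y : near_sub s C 0 x -> C (s y).
    apply; rewrite expr0 ler_norml.
    have := bary_ge0 ord_max x; have := bary_ge0 ord_max y.
    have := bary_ge0 ord0 x; have := bary_ge0 ord0 y; rewrite !bary_edge.
    by move=> *; apply/andP; split; lra.
  by case: (sN (edge 0)) => H; [left | right] => y; exact: near_all H.
have half (p : continuousType (simplex R 1) (simplex R 1)) :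
    (forall x y, bary ord_max (p x) - bary ord_max (p y) =
      (bary ord_max x - bary ord_max y) / 2) ->
    iter N (subdiv R (T i)) << comp_cts s p >> \in sml i 1.
  move=> p_half; apply: IH => x.
  have near_p C : near_sub s C N.+1 (p x) -> near_sub (comp_cts s p) C N x.
    move=> sC y xy; apply: sC; rewrite p_half normrM exprSr.
    by rewrite [X in _ * X]ger0_norm ?invr_ge0 // ler_pM2r ?invr_gt0.
  by case: (sN (p x)) => /near_p; [left | right].
rewrite iterSr subdivU raddfD; apply: rpredD; apply: half => x y.
  by rewrite !bary_left; lra.
by rewrite !bary_right; lra.
Qed.

Lemma iter_subdiv_eventually_small i (x : sing R (T i) 1) :
  exists N, iter N (subdiv R (T i)) x \in sml i 1.
Proof.
move: x; apply: freeg_subgroup_ind => [|s].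
  split=> [|x y [N xN] [M yM]]; first by exists 0%N; rewrite rpred0.
  exists (maxn N M); rewrite raddfB; apply: rpredB.
    exact: iter_subdiv_small (leq_maxl N M) xN.
  exact: iter_subdiv_small (leq_maxr N M) yM.
have [N sN] := lebesgue_number_edge (cover i) s.
by exists N; exact: iter_subdivU_small.
Qed.

(** * Vanishing in degrees 0 and 1 *)

Let Q := quot_crep (sum_subcrep (sing_subcrep R fT1) (sing_subcrep R fT2)).

Let Q_subdiv i : {additive Q i 1 -> Q i 1} :=
  quot_map (sml i 1) (sml i 1) (subdiv R (T i)) (@subdiv_small _ _ _ _ _ _).

Let Q_fold i : {additive Q i 1 -> Q i 2} :=
  quot_map (sml i 1) (sml i 2) (precomp (fold R) (T i))
    (@precomp_small _ _ _ _ _ _ _ _ _).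

Let cls i n : {additive sing R (T i) n -> Q i n} := \pi_{ideal_quot sml i n}.

Let Q_subdivE i x : Q_subdiv i (cls i 1 x) = cls i 1 (subdiv R (T i) x).
Proof. exact: quot_map_pi. Qed.

Let Q_foldE i x : Q_fold i (cls i 1 x) = cls i 2 (precomp (fold R) (T i) x).
Proof. exact: quot_map_pi. Qed.

Let Q_bdE i n x : bd (Q i) n (cls i n.+1 x) = cls i n (@sing_bd R (T i) n x).
Proof. exact: quot_map_pi. Qed.

Let Q_arrE a n x : carr Q a n (cls (source a) n x) =
  cls (target a) n (sing_fun R (tarr T a) n x).
Proof. exact: quot_map_pi. Qed.

Let clsP i n (x : Q i n) : exists y, x = cls i n y.
Proof. by elim/quotW: x => y; exists y. Qed.

Let cls_small i n x : x \in sml i n -> cls i n x = 0.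
Proof.
move=> xS; rewrite -(raddf0 (cls i n)); apply/eqP.
by rewrite -Quotient.idealrBE subr0.
Qed.

Lemma lim_quot_homology1_eq0 (h : homology (lim_crep Q) 1) : h = 0.
Proof.
apply: (@lim_homologyS_eq0 _ Q 0 Q_subdiv Q_fold).
- move=> i x; have [{x}x ->] := clsP x.
  by rewrite Q_foldE Q_bdE fold_bd raddfB Q_subdivE.
- move=> a x; have [{x}x ->] := clsP x.
  by rewrite Q_arrE !Q_subdivE Q_arrE subdiv_sing_fun.
- move=> a x; have [{x}x ->] := clsP x.
  by rewrite Q_arrE !Q_foldE Q_arrE precomp_sing_fun.
- move=> i x; have [{x}x ->] := clsP x.
  have [N xN] := iter_subdiv_eventually_small x; exists N.
  rewrite -(cls_small xN); elim: N {xN} => //= N ->.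
  exact: Q_subdivE.
Qed.

Lemma lim_quot_homology0_eq0 (h : homology (lim_crep Q) 0) : h = 0.
Proof.
apply: homology_eq0 h => -[z zP] _; exists 0.
have z0 : z = 0.
  apply: functional_extensionality_dep => i.
  by have [x ->] := clsP (z i); rewrite cls_small //; exact: sing0_small.
apply: val_inj; rewrite [RHS]z0.
apply: functional_extensionality_dep => i; exact: raddf0.
Qed.
End SmallSimplices.

(* MathComp-Analysis: the simplices live in an arbitrary model R of the reals. *)
Theorem theorem5p12 (R : realType) (G : quiver) (T : toprep G)
    (T' T'' : forall i : vertex G, set (T i))
    (hcover : forall i : vertex G, (T' i)° `|` (T'' i)° = [set: T i])
    (hT' : forall a : arrow G, tarr T a @` T' (source a) `<=` T' (target a))
    (hT'' : forall a : arrow G, tarr T a @` T'' (source a) `<=` T'' (target a))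
    (n : nat) (hn : n = 0%N \/ n = 1%N) :
  forall h : homology (lim_crep (quot_crep
      (sum_subcrep (sing_subcrep R hT') (sing_subcrep R hT'')))) n,
  h = 0.
Proof.
case: hn => -> h; first exact: lim_quot_homology0_eq0.
exact: lim_quot_homology1_eq0.
Qed.
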